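(* Let $X_N=\{x_0,\dots,x_N\}$, $W_N=\{w^{(N)}_0,\dots,w^{(N)}_N\}$ form an interpolatory quadrature rule, let $x_{N+1}\in\mathbb{R}\setminus X_N$, and let $$\varepsilon_{N+1} = \mu_{N+1}-\sum_{k=0}^N x_k^{N+1}w^{(N)}_k .$$ Then $X_{N+1}=X_N\cup\{x_{N+1}\}$ forms the nodal set of a positive interpolatory quadrature rule if and only if $$\frac{-\varepsilon_{N+1}}{\prod_{j=0,\,j\neq k}^{N+1}(x_k-x_j)}\;\le\; w^{(N)}_k \qquad\text{for all } k=0,\dots,N+1,$$ where $w^{(N)}_{N+1}:=0$.
   Context: Let $\Omega=[a,b]$ with $-\infty\le a<b\le\infty$ (intersected with $\mathbb{R}$) and let $\rho\colon\Omega\to[0,\infty)$ be a density function all of whose moments $\mu_j=\int_\Omega x^j\rho(x)\,dx$, $j\ge 0$, are finite. A quadrature rule with $n+1$ nodes ($n\ge0$) consists of pairwise distinct real nodes $x_0,\dots,x_n$ and real weights $w_0,\dots,w_n$. It is called interpolatory if $\sum_{k=0}^n x_k^jw_k=\mu_j$ for all $j=0,\dots,n$ (so the weights are uniquely determined by the nodes and the moments), and it is called positive if all of its weights are non-negative, i.e. $w_k\ge 0$ for all $k$. A finite set forms the nodal set of a positive interpolatory quadrature rule if there exist weights for which it becomes a positive interpolatory quadrature rule. Added nodes are allowed to be arbitrary real numbers (not necessarily in $\Omega$). The superscript in $w^{(N)}_k$ indicates the rule (with nodes $X_N$) to which the weight belongs. *)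

(* Defs.v *)
From mathcomp Require Import all_boot all_order all_algebra.
From mathcomp Require Import all_classical all_reals all_analysis.

Set Implicit Arguments.
Unset Strict Implicit.
Unset Printing Implicit Defensive.

Import Order.TTheory GRing.Theory Num.Theory.

Local Open Scope classical_set_scope.
Local Open Scope ring_scope.

(* [a, b] intersected with R, for possibly infinite endpoints *)
Definition real_interval (R : realType) (a b : \bar R) : set R :=
  [set x | (a <= x%:E <= b)%E].

(* [rho] is total, but only its values on [Omega] matter. Integrability at
   [j = 0] includes measurability of [rho] on [Omega]. No normalization
   [moment Omega rho 0 = 1] is required. *)
Definition density_with_moments (R : realType) (Omega : set R) (rho : R -> R) :=
  (forall x, Omega x -> 0 <= rho x) /\
  (forall j : nat,
    (@lebesgue_measure R).-integrable Omega (fun x => (x ^+ j * rho x)%:E)).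

Definition moment (R : realType) (Omega : set R) (rho : R -> R) (j : nat) : R :=
  \int[@lebesgue_measure R]_(x in Omega) (x ^+ j * rho x).

Definition interpolatory (R : realType) (mu : nat -> R) (n : nat)
    (x w : 'I_n.+1 -> R) : Prop :=
  injective x /\
  (forall j : nat, (j <= n)%N -> \sum_(k < n.+1) x k ^+ j * w k = mu j).

Definition positive_rule (R : realType) (n : nat) (w : 'I_n.+1 -> R) : Prop :=
  forall k, 0 <= w k.

Definition positive_interpolatory_nodal_set (R : realType) (mu : nat -> R)
    (X : set R) : Prop :=
  exists (n : nat) (x w : 'I_n.+1 -> R),
    [/\ range x = X, interpolatory mu x w & positive_rule w].

(* the family f_0, ..., f_N, c, of length N + 2 *)
Definition extend (R : Type) (N : nat) (f : 'I_N.+1 -> R) (c : R)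
    (k : 'I_N.+2) : R :=
  if unlift ord_max k is Some i then f i else c.

Definition next_moment_error (R : realType) (mu : nat -> R) (N : nat)
    (x w : 'I_N.+1 -> R) : R :=
  mu N.+1 - \sum_(k < N.+1) x k ^+ N.+1 * w k.

(* Main.v *)
(** The weights of a signed rule on distinct nodes y_0, ..., y_n whose moments
    of order less than n vanish and whose n-th moment is c must be
    c / prod_(j != k) (y_k - y_j): test the rule on the Lagrange basis. The
    difference between the interpolatory rule on X_(N+1) and the given rule,
    extended by a zero weight, is of this form with c = eps_(N+1), so the
    condition says exactly that the weights on X_(N+1) are nonnegative. *)
Require Import Defs.
From mathcomp Require Import all_boot all_order all_algebra.
From mathcomp Require Import all_classical all_reals all_analysis.

Set Implicit Arguments.
Unset Strict Implicit.
Unset Printing Implicit Defensive.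

Import Order.TTheory GRing.Theory Num.Theory.

Local Open Scope classical_set_scope.
Local Open Scope ring_scope.

Section LagrangeBasis.
Variables (F : fieldType) (n : nat) (y : 'I_n.+1 -> F).
Hypothesis y_inj : injective y.

(** The Lagrange basis polynomial left unnormalised: it stays monic of degree [n], and [node_prod k]
    is its value at its own node. *)
Definition node_poly (k : 'I_n.+1) : {poly F} :=
  \prod_(j < n.+1 | j != k) ('X - (y j)%:P).

Definition node_prod (k : 'I_n.+1) : F :=
  \prod_(j < n.+1 | j != k) (y k - y j).

Lemma node_prod_neq0 k : node_prod k != 0.
Proof.
apply/prodf_neq0 => j jk; rewrite subr_eq0; apply: contraNneq jk.
by move/y_inj ->.
Qed.

Lemma size_node_poly k : size (node_poly k) = n.+1.
Proof.
rewrite /node_poly -big_filter size_prod_XsubC size_filter -sum1_count.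
by rewrite (sum1_card (predC1 k)) cardC1 card_ord.
Qed.

Lemma node_poly_lead k : (node_poly k)`_n = 1.
Proof.
have /monicP : node_poly k \is monic by apply: monic_prod_XsubC.
by rewrite lead_coefE size_node_poly.
Qed.

Lemma horner_node_poly k i :
  (node_poly k).[y i] = if i == k then node_prod k else 0.
Proof.
rewrite horner_prod; case: eqVneq => [->|ik].
  by apply: eq_bigr => j _; rewrite !hornerE.
by rewrite (bigD1 i) //= !hornerE subrr mul0r.
Qed.

(** The difference of the two sides vanishes at [n.+1] distinct nodes but has degree at most [n], so
    it is zero. *)
Lemma lagrange_interpolation (p : {poly F}) : (size p <= n.+1)%N ->
  p = \sum_(k < n.+1) (p.[y k] / node_prod k) *: node_poly k.
Proof.
move=> sp; set q := \sum_(k < _) _; apply/eqP; rewrite -subr_eq0.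
apply: contraT => pq_neq0.
have sq : (size q <= n.+1)%N.
  apply: leq_trans (size_sum _ _ _) _; apply/bigmax_leqP => k _.
  by rewrite (leq_trans (size_scale_leq _ _)) // size_node_poly.
have roots_pq : all (root (p - q)) [seq y k | k <- enum 'I_n.+1].
  apply/allP => _ /mapP[i _ ->]; rewrite rootE hornerD hornerN horner_sum.
  rewrite (bigD1 i) //= big1 => [|k ki].
    by rewrite hornerZ horner_node_poly eqxx divfK ?node_prod_neq0// addr0 subrr.
  by rewrite hornerZ horner_node_poly eq_sym (negPf ki) mulr0.
have := max_poly_roots pq_neq0 roots_pq.
rewrite map_inj_uniq // enum_uniq size_map size_enum_ord => /(_ isT).
by rewrite ltnNge (leq_trans (size_polyD _ _)) // size_polyN geq_max sp.
Qed.

Lemma top_moment_weightsP (v : 'I_n.+1 -> F) (c : F) :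
  (forall j, (j <= n)%N -> \sum_(k < n.+1) y k ^+ j * v k = c *+ (j == n)) <->
  (forall k, v k = c / node_prod k).
Proof.
split=> [mom k|vE j jn].
  apply/(mulIf (node_prod_neq0 k)); rewrite divfK ?node_prod_neq0//.
  (* This sum is computed in two ways. Expanded in moments, only the leading coefficient 1 survives,
     which gives [c]; node by node, only [y k] contributes, which gives [node_prod k * v k]. *)
  have : \sum_(i < n.+1) (node_poly k).[y i] * v i = c.
    under eq_bigr do rewrite horner_coef size_node_poly mulr_suml.
    rewrite exchange_big /= big_ord_recr /= big1 => [|j _].
      rewrite add0r node_poly_lead; under eq_bigr do rewrite mul1r.
      by rewrite mom // eqxx.
    under eq_bigr do rewrite -mulrA.
    by rewrite -mulr_sumr mom 1?ltnW // (ltn_eqF (ltn_ord j)) mulr0.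
  rewrite (bigD1 k) //= big1 => [|i ik].
    by rewrite horner_node_poly eqxx addr0 mulrC.
  by rewrite horner_node_poly (negPf ik) mul0r.
(* Compare coefficients of degree [n] in the Lagrange form of ['X^j]: the left one is 1 exactly when
   [j = n], and on the right each monic [node_poly k] leaves [y k ^+ j / node_prod k]. *)
have /(congr1 (fun p : {poly F} => p`_n)) : 'X^j = _ :=
  @lagrange_interpolation 'X^j ltac:(by rewrite size_polyXn).
rewrite coefXn coef_sum eq_sym => /= cE; rewrite -mulr_natr cE mulr_sumr.
apply: eq_bigr => k _.
by rewrite coefZ node_poly_lead mulr1 hornerXn vE mulrCA.
Qed.

End LagrangeBasis.

Lemma extend_lift (T : Type) (N : nat) (f : 'I_N.+1 -> T) (c : T) i :
  extend f c (lift ord_max i) = f i.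
Proof. by rewrite /extend liftK. Qed.

Lemma extend_max (T : Type) (N : nat) (f : 'I_N.+1 -> T) (c : T) :
  extend f c ord_max = c.
Proof. by rewrite /extend unlift_none. Qed.

Lemma extend_inj (T : Type) (N : nat) (f : 'I_N.+1 -> T) (c : T) :
  injective f -> ~ range f c -> injective (extend f c).
Proof.
move=> f_inj fc i j.
case: (unliftP ord_max i) => [i'|] ->; case: (unliftP ord_max j) => [j'|] ->;
  rewrite ?extend_lift ?extend_max //.
- by move/f_inj ->.
- by move=> e; case: fc; exists i'.
- by move=> e; case: fc; exists j'.
Qed.

Lemma range_extend (T : Type) (N : nat) (f : 'I_N.+1 -> T) (c : T) :
  range (extend f c) = range f `|` [set c].
Proof.
apply/seteqP; split=> [_ [i _ <-]|_ [[i _ <-]|->]].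
- case: (unliftP ord_max i) => [i'|] ->; rewrite ?extend_lift ?extend_max.
    by left; exists i'.
  by right.
- by exists (lift ord_max i); rewrite ?extend_lift.
- by exists ord_max; rewrite ?extend_max.
Qed.

Lemma sum_extend (R : pzRingType) (N : nat) (x w : 'I_N.+1 -> R) (c : R) j :
  \sum_(k < N.+2) extend x c k ^+ j * extend w 0 k =
  \sum_(k < N.+1) x k ^+ j * w k.
Proof.
rewrite (bigD1_ord ord_max) //= !extend_max mulr0 add0r.
by apply: eq_bigr => i _; rewrite !extend_lift.
Qed.

(** A nodal set comes with an enumeration of its own. Two injective enumerations of one set differ
    by a bijection of the indices, along which the weights are transported. *)
Lemma positive_interpolatory_nodal_set_range (R : realType) (mu : nat -> R)
    (n : nat) (y : 'I_n.+1 -> R) : injective y ->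
  positive_interpolatory_nodal_set mu (range y) <->
  exists2 v : 'I_n.+1 -> R, interpolatory mu y v & positive_rule v.
Proof.
move=> y_inj; split=> [[m [x [w [xy [x_inj mom] w_ge0]]]]|[v yv v_ge0]]; last first.
  by exists n, y, v.
have /choice[s xsE] k : exists i, x i = y k.
  by have [i _ <-] : range x (y k) by [rewrite xy; exists k]; exists i.
have /choice[t ytE] i : exists k, y k = x i.
  by have [k _ <-] : range y (x i) by [rewrite -xy; exists i]; exists k.
have s_bij : bijective s.
  exists t => [k|i]; first by apply: y_inj; rewrite ytE xsE.
  by apply: x_inj; rewrite xsE ytE.
(* Equal lengths are needed for the moment conditions to reach the same order. *)
have [nm] : n.+1 = m.+1 by have := bij_eq_card s_bij; rewrite !card_ord.
exists (w \o s) => [|k]; last exact: w_ge0.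
split=> // j jn; rewrite -mom -?nm // [RHS](reindex s) /=; last exact: onW_bij.
by apply: eq_bigr => k _; rewrite xsE.
Qed.

Lemma interpolatory_extendP (R : realType) (mu : nat -> R) (N : nat)
    (x w : 'I_N.+1 -> R) (c : R) (v : 'I_N.+2 -> R) :
  interpolatory mu x w -> ~ range x c ->
  interpolatory mu (extend x c) v <->
  (forall k, v k - extend w 0 k =
    next_moment_error mu x w / node_prod (extend x c) k).
Proof.
move=> [x_inj mom] xc; have y_inj := extend_inj x_inj xc.
(* The given rule is exact up to order [N], so its first possible defect is the error at order
   [N.+1]. *)
have errE j : (j <= N.+1)%N -> mu j - \sum_(k < N.+1) x k ^+ j * w k =
    next_moment_error mu x w *+ (j == N.+1).
  by case: ltngtP => // [jN _|-> _ //]; rewrite mom ?subrr.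
have diffE j : \sum_(k < N.+2) extend x c k ^+ j * (v k - extend w 0 k) =
    \sum_(k < N.+2) extend x c k ^+ j * v k - \sum_(k < N.+1) x k ^+ j * w k.
  by under eq_bigr do rewrite mulrBr; rewrite sumrB sum_extend.
rewrite -(top_moment_weightsP y_inj (fun k => v k - extend w 0 k)).
split=> [[_ vmom] j jN|vmom]; first by rewrite diffE vmom // errE.
by split=> // j jN; have := vmom j jN; rewrite diffE -errE // => /addIr.
Qed.

Theorem theorem2 (R : realType) (a b : \bar R) (hab : (a < b)%E)
    (rho : R -> R) (hrho : density_with_moments (real_interval a b) rho)
    (N : nat) (x w : 'I_N.+1 -> R)
    (hxw : interpolatory (moment (real_interval a b) rho) x w)
    (xnew : R) (hxnew : ~ range x xnew) :
  positive_interpolatory_nodal_set (moment (real_interval a b) rho)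
    (range x `|` [set xnew]) <->
  (forall k : 'I_N.+2,
    - next_moment_error (moment (real_interval a b) rho) x w /
      \prod_(j < N.+2 | j != k) (extend x xnew k - extend x xnew j)
    <= extend w 0 k).
Proof.
set mu := moment _ _ in hxw *; set eps := next_moment_error _ _ _.
rewrite -range_extend positive_interpolatory_nodal_set_range; last first.
  by apply: extend_inj => //; case: hxw.
split=> [[v /(interpolatory_extendP _ hxw hxnew) vE v_ge0] k|wle].
  by rewrite mulNr lerNl -vE lerBrDr addrC subrr v_ge0.
(* By [interpolatory_extendP] these are the only possible weights; the assumed inequality is their
   nonnegativity. *)
exists (fun k => extend w 0 k + eps / node_prod (extend x xnew) k) => [|k].
  by apply/(interpolatory_extendP _ hxw hxnew) => k; rewrite addrC addKr.
by have := wle k; rewrite mulNr -subr_ge0 opprK.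
Qed.
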